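(* Let $3\le n\le 6$. In the Newtonian $n$-body problem (potential $U_\alpha$ with $\alpha=1$), the regular $n$-gon with equal masses is the unique central configuration such that all the bodies lie on a circle and the center of mass coincides with the center of the circle. That is: let $m_1,\dots,m_n>0$ and let $x_1,\dots,x_n$ be pairwise distinct points lying on a common circle whose center is the center of mass $c_0=\frac{\sum_k m_kx_k}{\sum_k m_k}$. Then $(x_1,\dots,x_n)$ is a Newtonian central configuration for the masses $(m_1,\dots,m_n)$ if and only if $m_1=\dots=m_n$ and $x_1,\dots,x_n$ are (in some order) the vertices of a regular $n$-gon.
   Context: For masses $m_1,\dots,m_n>0$ and pairwise distinct points $x_1,\dots,x_n\in\mathbb{R}^3$, the configuration $(x_1,\dots,x_n)$ is a Newtonian central configuration if there is a constant $\lambda\in\mathbb{R}$ such that $$\sum_{j\ne k}\frac{x_j-x_k}{|x_j-x_k|^{3}}m_jm_k=-\lambda m_k(x_k-c_0),\qquad k=1,\dots,n,$$ where $c_0=\frac{\sum_{k}m_kx_k}{\sum_k m_k}$ is the center of mass. Circles have positive radius and lie in a plane. Central configurations are considered modulo rotations, translations and dilations. *)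

(* Defs.v *)
From HB Require Import structures.
From mathcomp Require Import all_boot all_order all_algebra all_fingroup.
From mathcomp Require Import all_classical all_reals all_analysis.
Set Implicit Arguments.
Unset Strict Implicit.
Unset Printing Implicit Defensive.
Import Order.TTheory GRing.Theory Num.Theory.
Local Open Scope classical_set_scope.
Local Open Scope ring_scope.

Definition dot (R : realType) (d : nat) (u v : 'rV[R]_d) : R :=
  \sum_(i < d) u 0 i * v 0 i.

(* The library norm `|u| on row vectors is the sup norm, hence this one. *)
Definition enorm (R : realType) (d : nat) (u : 'rV[R]_d) : R :=
  Num.sqrt (dot u u).

Definition center_of_mass (R : realType) (n : nat)
    (m : 'I_n -> R) (x : 'I_n -> 'rV[R]_3) : 'rV[R]_3 :=
  (\sum_k m k)^-1 *: \sum_k m k *: x k.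

(* Only meaningful when the masses are positive and the x k pairwise distinct. *)
Definition central_configuration (R : realType) (n : nat)
    (m : 'I_n -> R) (x : 'I_n -> 'rV[R]_3) : Prop :=
  exists lambda : R, forall k : 'I_n,
    \sum_(j < n | j != k)
       (m j * m k / enorm (x j - x k) ^+ 3) *: (x j - x k)
    = - (lambda * m k) *: (x k - center_of_mass m x).

(* Circle of center c and radius r in the plane through c with normal w
   (w <> 0, r > 0). *)
Definition circle (R : realType) (c w : 'rV[R]_3) (r : R) : set 'rV[R]_3 :=
  [set y | enorm (y - c) = r /\ dot (y - c) w = 0].

Definition is_circle_centered (R : realType) (c : 'rV[R]_3)
    (C : set 'rV[R]_3) : Prop :=
  exists (w : 'rV[R]_3) (r : R), [/\ w != 0, 0 < r & C = circle c w r].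

(* (u, v) is an orthonormal basis of the plane of the polygon; the permutation
   s allows the x k to be the vertices in any order. *)
Definition regular_polygon (R : realType) (n : nat)
    (x : 'I_n -> 'rV[R]_3) : Prop :=
  exists (c u v : 'rV[R]_3) (r : R) (s : {perm 'I_n}),
    [/\ 0 < r, dot u u = 1, dot v v = 1, dot u v = 0 &
      forall k : 'I_n,
        let theta := 2 * pi * k%:R / n%:R in
        x (s k) = c + r *: (cos theta *: u + sin theta *: v)].

(* Main.v *)
(* Write the bodies as points of angles a_k of a circle. The radial equations,
   the tangential equations and the centering condition combine into: a is a
   critical point of the energy sum m_i m_j g((a_j - a_i)/2), and
   sum_j m_j g((a_j - a_i)/2) does not depend on i, where
   g(s) = 1/sin s + (sin s)^2/2. The coefficient 1/2 is the largest one for which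
   g is convex on (0, pi). By convexity, at fixed masses and cyclic order a
   critical point is the unique minimum of the energy; so a beats the regular
   n-gon for the masses m, and the regular n-gon beats a for equal masses.
   The average of g over the regular n-gon, self-interaction 0 included, is below
   min g = 3/2 when n <= 6, and then a Perron-type argument shows that
   both matrices of interactions are negative semidefinite on vectors of sum 0.
   Comparing the energies of m and of its mean leaves only equality. *)
Require Import Defs.
From HB Require Import structures.
From mathcomp Require Import all_boot all_order all_algebra all_fingroup.
From mathcomp Require Import all_classical all_reals all_analysis.
From mathcomp Require Import ring lra zify.
Import Order.TTheory GRing.Theory Num.Theory.
Import numFieldNormedType.Exports.
Local Open Scope classical_set_scope.
Local Open Scope ring_scope.

(** * Pair potential on the circle and its convexity *)

(** The half angle makes [2 * |sin (d / 2)|] a chord of the unit circle; the absolute value makes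
    [pot] even and 2 pi periodic. *)
Definition pot {R : realType} (d : R) : R :=
  `|sin (d / 2)|^-1 + sin (d / 2) ^+ 2 / 2.

(* Twice the derivative of [pot]; the junk value [0^-1 = 0] makes both
   functions ignore the self-interaction [d = 0]. *)
Definition dpot {R : realType} (d : R) : R :=
  sin (d / 2) * cos (d / 2) - cos (d / 2) / (sin (d / 2) * `|sin (d / 2)|).

Lemma is_derive_csc_sqr {R : realType} (s : R) : 0 < sin s ->
  is_derive s 1 (fun t => (sin t)^-1 + sin t ^+ 2 / 2)
    (sin s * cos s - cos s / (sin s * sin s)).
Proof.
move=> s0; have sn0 : sin s != 0 by rewrite gt_eqF.
have hV := is_deriveV sn0 (is_derive_sin s).
have hX : is_derive s 1 (fun t : R => sin t ^+ 2 / 2) (sin s * cos s).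
  rewrite (_ : (fun t : R => _) = 2^-1 *: (sin ^+ 2)); last first.
    by apply/funext => t /=; rewrite fctE /GRing.scale /= mulrC.
  by apply: is_derive_eq; rewrite /GRing.scale /=; field.
apply: is_derive_eq (is_deriveD hV hX) _.
by rewrite /GRing.scale /=; field.
Qed.

(** The slope equals - cos s times (1/sin^2 s - sin s), whose second factor is nonnegative and
    decreasing in sin s. Comparing the signs of the two cosines then replaces a second
    derivative. *)
Lemma csc_sqr_slope_lt {R : realType} (s t : R) :
  0 < s < pi -> 0 < t < pi -> s < t ->
  sin s * cos s - cos s / (sin s * sin s) < sin t * cos t - cos t / (sin t * sin t).
Proof.
move=> hs ht st.
have s0 := sin_gt0_pi hs; have t0 := sin_gt0_pi ht.
have cst : cos t < cos s.
  by rewrite ltr_cos // in_itv /=; move: hs ht; lra.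
have es := sin2cos2 s; have et := sin2cos2 t.
have a1 := sin_le1 s; have b1 := sin_le1 t.
move: s0 t0 cst es et a1 b1.
move: (sin s) (sin t) (cos s) (cos t) => a b c d a0 b0 dc es et a1 b1.
have fdec (u v : R) : 0 < u -> u < v -> (v * v)^-1 - v < (u * u)^-1 - u.
  move=> u0 uv; have v0 : 0 < v := lt_trans u0 uv.
  by rewrite ltrB // ltf_pV2 ?posrE ?mulr_gt0 // ltr_pM // ltW.
have f1 (u : R) : 0 < u -> u <= 1 -> 0 <= (u * u)^-1 - u.
  rewrite le_eqVlt => u0 /orP[/eqP-> | u1]; first by rewrite mulr1 invr1 subrr.
  by have := fdec u 1 u0 u1; rewrite mulr1 invr1; lra.
have f1' (u : R) : 0 < u -> u < 1 -> 0 < (u * u)^-1 - u.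
  by move=> u0 u1; have := fdec u 1 u0 u1; rewrite mulr1 invr1; lra.
have fE (u w : R) : u * w - w / (u * u) = - (w * ((u * u)^-1 - u)) by ring.
have sqr_lt (u v : R) : 0 < u -> 0 < v -> u ^+ 2 < v ^+ 2 -> u < v.
  by move=> u0 v0; rewrite ltr_pXn2r ?nnegrE ?ltW.
rewrite !fE ltrN2.
have [d0|d0] := leP 0 d.
  have ab : a < b by apply: sqr_lt => //; rewrite es et ltrD2l ltrN2 ltr_pXn2r ?nnegrE //; lra.
  by apply: ltr_pM => //; [exact: f1|exact: fdec].
have hb : 0 < (b * b)^-1 - b.
  apply: f1' => //; apply: sqr_lt => //.
  by rewrite et expr1n ltrBlDr ltrDl exprn_even_gt0 //= lt_eqF.
have [c0|c0] := leP c 0.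
  have ab : b < a.
    apply: sqr_lt => //; rewrite es et ltrD2l ltrN2 -[c ^+ 2]sqrrN -[d ^+ 2]sqrrN.
    by rewrite ltr_pXn2r ?nnegrE //; lra.
  rewrite -ltrN2 -!mulNr; apply: ltr_pM; [lra|exact: f1|lra|exact: fdec].
apply: (@lt_le_trans _ _ 0); first by rewrite pmulr_llt0.
by rewrite mulr_ge0 ?f1 // ltW.
Qed.

Lemma mean_value {R : realType} (f df : R -> R) (a b : R) : a < b ->
  (forall z, z \in `[a, b]%R -> is_derive z 1 f (df z)) ->
  exists2 z, a < z < b & f b - f a = df z * (b - a).
Proof.
move=> ab h.
have hoo : forall x, x \in `]a, b[%R -> is_derive x 1 f (df x).
  by move=> x /subset_itv_oo_cc; exact: h.
have hc : {within `[a, b], continuous f}.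
  apply: derivable_within_continuous => z zab.
  by have [] := h z zab.
have [z] := MVT ab hoo hc.
by rewrite in_itv /= => zab e; exists z.
Qed.

(** The mean value theorem yields a slope at a point strictly between [s] and [t], which is compared
    with [df s]. *)
Lemma above_tangent {R : realType} (f df : R -> R) (l u : R) :
  (forall z, l < z < u -> is_derive z 1 f (df z)) ->
  (forall s t, l < s < u -> l < t < u -> s < t -> df s < df t) ->
  forall s t, l < s < u -> l < t < u -> s != t ->
  f s + df s * (t - s) < f t.
Proof.
move=> hd hdf s t hs ht; case: (ltgtP s t) => // [st|ts] _.
- have [|z zst e] := @mean_value _ f df s t st.
    by move=> z; rewrite in_itv /= => zst; apply: hd; lra.
  have : df s < df z by apply: hdf; lra.
  by rewrite -ltrBrDl e ltr_pM2r ?subr_gt0.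
- have [|z zst e] := @mean_value _ f df t s ts.
    by move=> z; rewrite in_itv /= => zst; apply: hd; lra.
  have : df z < df s by apply: hdf; lra.
  by rewrite -ltrBrDl -(opprB (f s)) e -mulrN opprB ltr_nM2r ?subr_lt0.
Qed.

Lemma csc_sqr_above_tangent {R : realType} (s t : R) :
  0 < s < pi -> 0 < t < pi -> s != t ->
  (sin s)^-1 + sin s ^+ 2 / 2
    + (sin s * cos s - cos s / (sin s * sin s)) * (t - s)
  < (sin t)^-1 + sin t ^+ 2 / 2.
Proof.
apply: (above_tangent (fun t : R => (sin t)^-1 + sin t ^+ 2 / 2)
  (fun s : R => sin s * cos s - cos s / (sin s * sin s)) 0 pi) => [z hz|x y].
  exact/is_derive_csc_sqr/sin_gt0_pi.
exact: csc_sqr_slope_lt.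
Qed.

Lemma pot0 {R : realType} : pot (0 : R) = 0.
Proof. by rewrite /pot mul0r sin0 normr0 invr0 expr0n /= mul0r addr0. Qed.

Lemma potN {R : realType} (d : R) : pot (- d) = pot d.
Proof. by rewrite /pot mulNr sinN normrN sqrrN. Qed.

Lemma dpotN {R : realType} (d : R) : dpot (- d) = - dpot d.
Proof. by rewrite /dpot mulNr sinN cosN normrN !mulNr invrN mulrN opprB opprK addrC. Qed.

Lemma half_2pi {R : realType} (d : R) : (d + 2 * pi) / 2 = d / 2 + pi.
Proof. by field. Qed.

Lemma potD2pi {R : realType} (d : R) : pot (d + 2 * pi) = pot d.
Proof. by rewrite /pot half_2pi sinDpi normrN sqrrN. Qed.

Lemma dpotD2pi {R : realType} (d : R) : dpot (d + 2 * pi) = dpot d.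
Proof.
by rewrite /dpot half_2pi sinDpi cosDpi normrN !mulNr mulrN opprK invrN mulrN opprK.
Qed.

Lemma sin_half_gt0 {R : realType} (d : R) : 0 < d -> d < 2 * pi -> 0 < sin (d / 2).
Proof. by move=> d0 d1; apply: sin_gt0_pi; lra. Qed.

Lemma sin_half_neq0 {R : realType} (d : R) :
  d != 0 -> `|d| < 2 * pi -> sin (d / 2) != 0.
Proof.
move=> d0 d1; have := sin_half_gt0 (`|d|).
rewrite normr_gt0 => /(_ d0 d1); case: (ger0P d) => _; first by move/gt_eqF->.
by rewrite mulNr sinN => h; rewrite -oppr_eq0 gt_eqF.
Qed.

Lemma pot_above_tangent {R : realType} (a b : R) :
  0 < a -> a < 2 * pi -> 0 < b -> b < 2 * pi -> a != b ->
  pot a + dpot a * ((b - a) / 2) < pot b.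
Proof.
move=> a0 a1 b0 b1 ab.
have sa := sin_half_gt0 _ a0 a1; have sb := sin_half_gt0 _ b0 b1.
rewrite /pot /dpot !gtr0_norm // (mulrBl _ b a).
apply: csc_sqr_above_tangent; [lra|lra|].
by apply: contra ab => /eqP e; apply/eqP; lra.
Qed.

(* The convex function [y^-1 + y^2/2] has its minimum 3/2 at [y = 1]. *)
Lemma pot_ge {R : realType} (d : R) : sin (d / 2) != 0 -> 3 / 2 <= pot d.
Proof.
rewrite /pot -real_normK ?num_real // -normr_gt0.
move: (`|sin _|) => y y0; rewrite -subr_ge0.
have -> : y^-1 + y ^+ 2 / 2 - 3 / 2 = (y - 1) ^+ 2 * (y + 2) / (2 * y).
  by field; rewrite gt_eqF.
apply: divr_ge0; last by rewrite mulr_ge0 ?ltW.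
by apply: mulr_ge0; [exact: sqr_ge0|lra].
Qed.

(** * Quadratic forms and comparison of energies *)

(** With v i = m i * y i, symmetrizing turns the difference of the two sides into the sum of the A i
    j m i m j (y i - y j)^2 / 2. Diagonal terms cancel, so they may be negative, as they are for
    [pot - 3/2]. *)
Lemma form_le {R : realType} (n : nat) (A : 'I_n -> 'I_n -> R) (m v : 'I_n -> R) :
  (forall i j, A i j = A j i) -> (forall i j, i != j -> 0 <= A i j) ->
  (forall i, 0 < m i) ->
  \sum_i \sum_j A i j * v i * v j <= \sum_i v i ^+ 2 / m i * \sum_j A i j * m j.
Proof.
move=> Asym Age0 m0.
pose y i := v i / m i.
have vE i : v i = m i * y i by rewrite /y mulrC divfK // gt_eqF.
pose F i j := A i j * m i * m j * y i ^+ 2.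
have -> : \sum_i v i ^+ 2 / m i * (\sum_j A i j * m j) = \sum_i \sum_j F i j.
  apply: eq_bigr => i _; rewrite mulr_sumr; apply: eq_bigr => j _.
  by rewrite /F vE; field; rewrite gt_eqF.
have -> : \sum_i \sum_j F i j = \sum_i \sum_j (F i j + F j i) / 2.
  have e : \sum_i \sum_j F j i = \sum_i \sum_j F i j by rewrite exchange_big.
  transitivity (\sum_i (\sum_j F i j + \sum_j F j i) / 2).
    by rewrite -mulr_suml big_split /= e; field.
  by apply: eq_bigr => i _; rewrite -mulr_suml big_split.
apply: ler_sum => i _; apply: ler_sum => j _; rewrite /F !vE (Asym j i).
have [->|ij] := eqVneq i j; first by rewrite le_eqVlt; apply/orP; left; apply/eqP; field.
have w0 : 0 <= A i j * m i * m j by rewrite !mulr_ge0 ?Age0 ?ltW.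
rewrite -subr_ge0.
have -> : (A i j * m i * m j * y i ^+ 2 + A i j * m j * m i * y j ^+ 2) / 2
    - A i j * (m i * y i) * (m j * y j)
  = A i j * m i * m j * ((y i - y j) ^+ 2 / 2) by field.
by rewrite mulr_ge0 // divr_ge0 ?sqr_ge0.
Qed.

Definition energy {R : realType} {n : nat} (m a : 'I_n -> R) : R :=
  \sum_i \sum_j m i * m j * pot (a j - a i).

(** Critical points of the energy: for distinct angles, the sum is the partial derivative of
    [energy m] in [a i], divided by [- m i]. *)
Definition balanced {R : realType} {n : nat} (m a : 'I_n -> R) :=
  forall i, \sum_j m j * dpot (a j - a i) = 0.

(** The common order puts a j - a i and b j - b i in the same interval of convexity, where [pot]
    lies above its tangents [D]; the linear terms cancel by balance. *)
Lemma energy_ge {R : realType} {n : nat} (m a b : 'I_n -> R) :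
  (forall i, 0 < m i) -> balanced m a ->
  (forall i j, (a i < a j) = (b i < b j)) ->
  (forall i j, a j - a i < 2 * pi) -> (forall i j, b j - b i < 2 * pi) ->
  energy m a <= energy m b /\
  (energy m b <= energy m a -> forall i j, a j - a i = b j - b i).
Proof.
move=> m0 bal ab ra rb.
pose D i j := pot (a j - a i) + dpot (a j - a i) * ((b j - b i - (a j - a i)) / 2).
have Dlt i j : a i < a j -> a j - a i != b j - b i -> D i j < pot (b j - b i).
  move=> aij; have bij : b i < b j by rewrite -ab.
  by apply: pot_above_tangent; rewrite ?subr_gt0 ?ra ?rb.
have Dsym i j : D j i = D i j.
  by rewrite /D -(opprB (a j)) -(opprB (b j)) potN dpotN; field.
have Dlt' i j : a j - a i != b j - b i -> D i j < pot (b j - b i).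
  case: (ltgtP (a i) (a j)) => [aij|aji|e].
  - exact: Dlt.
  - rewrite -Dsym -(opprB (a i)) -(opprB (b i)) potN eqr_opp; exact: Dlt.
  - have := ab i j; have := ab j i; rewrite e ltxx => /esym h1 /esym h2.
    have -> : b i = b j by apply/le_anti; rewrite !leNgt h1 h2.
    by rewrite !subrr eqxx.
have Dle i j : D i j <= pot (b j - b i).
  have [e|/Dlt'/ltW //] := eqVneq (a j - a i) (b j - b i).
  by rewrite /D e subrr mul0r mulr0 addr0.
have sumD : \sum_i \sum_j m i * m j * D i j = energy m a.
  (* The linear part of [D] splits into [G] and [H], due to the displacements of [j] and of [i];
     each vanishes by the balance equation of that body. *)
  pose G i j := m i * (m j * dpot (a j - a i)) * ((b j - a j) / 2).
  pose H i j := m i * (m j * dpot (a j - a i)) * ((b i - a i) / 2).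
  have G0 : \sum_i \sum_j G i j = 0.
    rewrite exchange_big big1 // => j _.
    transitivity (\sum_i (m i * dpot (a i - a j)) * (- m j * ((b j - a j) / 2))).
      by apply: eq_bigr => i _; rewrite /G -(opprB (a i)) dpotN; field.
    by rewrite -mulr_suml bal mul0r.
  have H0 : \sum_i \sum_j H i j = 0.
    rewrite big1 // => i _; rewrite -mulr_suml -mulr_sumr bal.
    by rewrite mulr0 mul0r.
  transitivity (energy m a + \sum_i \sum_j G i j - \sum_i \sum_j H i j);
    last by rewrite G0 H0 addr0 subr0.
  rewrite -big_split -sumrB /=.
  apply: eq_bigr => i _; rewrite -big_split -sumrB /=; apply: eq_bigr => j _.
  by rewrite /D /G /H; field.
have mm i j : 0 < m i * m j by rewrite mulr_gt0.
have le2 i j : m i * m j * D i j <= m i * m j * pot (b j - b i).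
  by rewrite ler_pM2l.
split=> [|ba i j].
  by rewrite -sumD; apply: ler_sum => i _; apply: ler_sum.
(* A single pair with different gaps would make the whole energy inequality strict. *)
apply/eqP/negP => /negP/Dlt' lt.
have : energy m a < energy m b; last by rewrite ltNge ba.
rewrite -sumD /energy (bigD1 i) //= [ltRHS](bigD1 i) //=.
apply: ltr_leD; last by apply: ler_sum => k _; apply: ler_sum.
rewrite (bigD1 j) //= [ltRHS](bigD1 j) //=.
apply: ltr_leD; last by apply: ler_sum.
by rewrite ltr_pM2l.
Qed.

(** A constant [k] does not act on vectors of sum 0. So 3/2, the lower bound of [pot] off the
    diagonal, can be subtracted to sharpen [form_le], while the form still expands into energies. *)
Lemma form_centered {R : realType} {n : nat} (A : 'I_n -> 'I_n -> R)
    (m : 'I_n -> R) (mu k : R) :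
  (forall i j, A i j = A j i) -> \sum_i (m i - mu) = 0 ->
  \sum_i \sum_j (A i j - k) * (m i - mu) * (m j - mu)
  = \sum_i \sum_j m i * m j * A i j - 2 * mu * (\sum_i m i * \sum_j A i j)
    + mu ^+ 2 * \sum_i \sum_j A i j.
Proof.
move=> Asym v0.
have e1 : \sum_i \sum_j m i * A i j = \sum_i m i * \sum_j A i j.
  by apply: eq_bigr => i _; rewrite mulr_sumr.
have e2 : \sum_i \sum_j m j * A i j = \sum_i m i * \sum_j A i j.
  rewrite exchange_big; apply: eq_bigr => i _; rewrite mulr_sumr.
  by apply: eq_bigr => j _; rewrite Asym.
have e3 : \sum_i \sum_j k * (m i - mu) * (m j - mu) = 0.
  by rewrite big1 // => i _; rewrite -mulr_sumr v0 mulr0.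
have e4 : 2 * mu * (\sum_i m i * \sum_j A i j)
    = mu * (\sum_i \sum_j m i * A i j) + mu * (\sum_i \sum_j m j * A i j).
  by rewrite e1 e2; ring.
rewrite e4 -[RHS]subr0 -[X in _ = _ - X]e3 !mulr_sumr.
rewrite -big_split -sumrB -big_split -sumrB /=; apply: eq_bigr => i _.
rewrite !mulr_sumr -big_split -sumrB -big_split -sumrB /=.
by apply: eq_bigr => j _; ring.
Qed.

Lemma sqr_sum_eq0 {R : realType} {n : nat} (v : 'I_n -> R) :
  \sum_i v i ^+ 2 <= 0 -> forall i, v i = 0.
Proof.
move=> h i; apply/eqP; rewrite -sqrf_eq0; apply/eqP.
have h0 : \sum_i v i ^+ 2 == 0.
  by rewrite eq_le h sumr_ge0 // => j _; rewrite sqr_ge0.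
move: h0; rewrite psumr_eq0; last by move=> j _; rewrite sqr_ge0.
by move/allP/(_ i)/(_ (mem_index_enum _))/eqP.
Qed.

Lemma sumr_gt0_ord {R : realType} {n : nat} (m : 'I_n -> R) :
  (0 < n)%N -> (forall i, 0 < m i) -> 0 < \sum_i m i.
Proof.
case: n m => // n m _ m0.
by rewrite big_ord_recl ltr_pwDl ?sumr_ge0 // => i _; exact: ltW.
Qed.

(* The Perron bound [form_le] makes both forms [pot - 3/2] nonpositive on
   [v = m - mu], which closes the chain
   [M T / n <= mu^2 energy 1 a / M <= c <= M T / n - S (3n/2 - T) / M],
   where [S] is the sum of the squares of [v]. *)
Lemma centered_unique {R : realType} {n : nat} (m a b : 'I_n -> R) (c T : R) :
  (0 < n)%N -> (forall i, 0 < m i) -> injective a ->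
  (forall i j, (a i < a j) = (b i < b j)) ->
  (forall i j, a j - a i < 2 * pi) -> (forall i j, b j - b i < 2 * pi) ->
  balanced m a -> (forall i, \sum_j m j * pot (a j - a i) = c) ->
  balanced (fun=> 1) b -> (forall i, \sum_j pot (b j - b i) = T) ->
  T < n%:R * (3 / 2) ->
  (forall i j, m i = m j) /\ (forall i j, a j - a i = b j - b i).
Proof.
move=> n0 m0 ainj ab ra rb bala rowa balb rowb Tn.
have ba i j : (b i < b j) = (a i < a j) by rewrite ab.
have binj : injective b.
  by move=> i j e; apply: ainj; apply/le_anti; rewrite !leNgt !ab e ltxx.
have nR : 0 < n%:R :> R by rewrite ltr0n.
pose M := \sum_i m i; pose mu := M / n%:R.
have M0 : 0 < M by exact: sumr_gt0_ord.
have mu0 : 0 < mu by rewrite divr_gt0.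
have muM : n%:R * mu = M by rewrite /mu mulrC divfK // gt_eqF.
have v0 : \sum_i (m i - mu) = 0.
  by rewrite sumrB sumr_const card_ord -[mu *+ n]mulr_natl muM subrr.
have psym (x : 'I_n -> R) i j : pot (x j - x i) = pot (x i - x j).
  by rewrite -potN opprB.
have pge (x : 'I_n -> R) i j : injective x ->
    (forall i j, x j - x i < 2 * pi) -> i != j -> 0 <= pot (x j - x i) - 3 / 2.
  move=> xinj rx ij; rewrite subr_ge0; apply/pot_ge/sin_half_neq0.
    by rewrite subr_eq0; apply: contra ij => /eqP/xinj ->.
  by rewrite ltr_norml rx andbT ltrNl opprB rx.
pose S := \sum_i (m i - mu) ^+ 2.
pose S' := \sum_i (m i - mu) ^+ 2 / m i.
have S'0 : 0 <= S' by apply: sumr_ge0 => i _; rewrite divr_ge0 ?sqr_ge0 ?ltW.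
have formb := @form_centered R n (fun i j => pot (b j - b i)) m mu (3 / 2)
  (psym b) v0.
(* The positive vector fed to [form_le] is 1 for [b] and [m] for [a]: applied to it, the interaction
   matrix has constant row sums, [T] and [c]. *)
have leb := @form_le R n (fun i j => pot (b j - b i) - 3 / 2) (fun=> 1)
  (fun i => m i - mu) _ (fun i j => pge b i j binj rb) (fun=> ltr01).
have forma := @form_centered R n (fun i j => pot (a j - a i)) m mu (3 / 2)
  (psym a) v0.
have lea := @form_le R n (fun i j => pot (a j - a i) - 3 / 2) m
  (fun i => m i - mu) _ (fun i j => pge a i j ainj ra) m0.
have {}leb := leb (fun i j => congr1 (fun x => x - 3 / 2) (psym b i j)).
have {}lea := lea (fun i j => congr1 (fun x => x - 3 / 2) (psym a i j)).
have [Eab _] := energy_ge m a b m0 bala ab ra rb.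
have [Eba Eeq] := energy_ge (fun=> 1) b a (fun=> ltr01) balb ba rb ra.
have E1 x : energy (fun=> 1) x = \sum_i \sum_j pot (x j - x i) :> R.
  by apply: eq_bigr => i _; apply: eq_bigr => j _; rewrite !mul1r.
have E1b : energy (fun=> 1) b = n%:R * T.
  rewrite E1 (eq_bigr (fun=> T)) => [|i _]; last exact: rowb.
  by rewrite sumr_const card_ord mulr_natl.
have Eam : energy m a = M * c.
  rewrite /energy mulr_suml; apply: eq_bigr => i _.
  by rewrite -(rowa i) mulr_sumr; apply: eq_bigr => j _; rewrite mulrA.
have crossb : \sum_i m i * \sum_j pot (b j - b i) = M * T.
  by rewrite mulr_suml; apply: eq_bigr => i _; rewrite rowb.
have crossa : \sum_i m i * \sum_j pot (a j - a i) = n%:R * c.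
  transitivity (\sum_i \sum_j m j * pot (a j - a i)).
    rewrite [RHS]exchange_big; apply: eq_bigr => i _; rewrite mulr_sumr.
    by apply: eq_bigr => j _; rewrite psym.
  rewrite (eq_bigr (fun=> c)) => [|i _]; last exact: rowa.
  by rewrite sumr_const card_ord mulr_natl.
have rhsb : \sum_i (m i - mu) ^+ 2 / 1 * (\sum_j (pot (b j - b i) - 3 / 2) * 1)
    = S * (T - n%:R * (3 / 2)).
  rewrite mulr_suml; apply: eq_bigr => i _; rewrite divr1; congr (_ * _).
  under eq_bigr do rewrite mulr1.
  by rewrite sumrB rowb sumr_const card_ord -[_ *+ n]mulr_natl.
have rhsa : \sum_i (m i - mu) ^+ 2 / m i * (\sum_j (pot (a j - a i) - 3 / 2) * m j)
    = S' * (c - 3 / 2 * M).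
  rewrite mulr_suml; apply: eq_bigr => i _; congr (_ * _).
  rewrite -(rowa i) /M mulr_sumr -sumrB; apply: eq_bigr => j _; ring.
move: leb; rewrite rhsb formb -/(energy m b) crossb -E1 E1b => {rhsb formb crossb} leb.
move: lea; rewrite rhsa forma -/(energy m a) crossa -E1 Eam => {rhsa forma crossa} lea.
have S0 : 0 <= S by apply: sumr_ge0 => i _; rewrite sqr_ge0.
have h1 : M * c <= mu * M * T - S * (n%:R * (3 / 2) - T).
  rewrite -Eam (le_trans Eab) //; move: leb; rewrite -muM; lra.
(* The form at [a] has a known sign only once c < 3M/2, so this bound is first drawn from the form
   at [b] and from T < 3n/2. *)
have c_lt : c < 3 / 2 * M.
  have : M * c <= M * (mu * T).
    apply: le_trans h1 _; rewrite lerBlDr mulrA (mulrC mu) lerDl mulr_ge0 //; lra.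
  rewrite ler_pM2l // => /le_lt_trans; apply.
  rewrite (_ : 3 / 2 * M = mu * (n%:R * (3 / 2))) ?ltr_pM2l //.
  by rewrite -muM; ring.
have h2 : mu ^+ 2 * energy (fun=> 1) a <= M * c.
  have : S' * (c - 3 / 2 * M) <= 0 by rewrite mulr_ge0_le0 //; lra.
  by move: lea; rewrite -muM; lra.
have h3 : mu ^+ 2 * (n%:R * T) <= mu ^+ 2 * energy (fun=> 1) a.
  by rewrite ler_pM2l ?exprn_gt0 // -E1b.
have muT : mu ^+ 2 * (n%:R * T) = mu * M * T by rewrite -muM; ring.
have Sle : S <= 0.
  by rewrite -(@pmulr_lle0 _ (n%:R * (3 / 2) - T)) ?subr_gt0 //; lra.
have {S0}Seq : S = 0 by apply/le_anti; rewrite Sle S0.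
have mE := sqr_sum_eq0 _ Sle.
split=> [i j|i j].
  by have := mE i; have := mE j => /= /subr0_eq -> /subr0_eq ->.
(* With S = 0 the chain closes up for equal masses too, which is the equality case of
   [energy_ge]. *)
apply/esym/Eeq; rewrite -(@ler_pM2l _ (mu ^+ 2)) ?exprn_gt0 //.
by rewrite E1b muT; move: h1; rewrite Seq mul0r; lra.
Qed.

(** * Sums over the regular polygon *)

Definition ngon {R : realType} {n : nat} (k : 'I_n) : R := 2 * pi * k%:R / n%:R.

(** Rotation by vertex [k] is addition in ['I_n]; each wrap-around costs one period. *)
Lemma ngon_sumB {R : realType} {n : nat} (F : R -> R) (k : 'I_n) :
  (forall x, F (x + 2 * pi) = F x) ->
  \sum_(j < n) F (ngon j - ngon k) = \sum_(j < n) F (ngon j).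
Proof.
case: n k => [[]//|n] k Fper.
rewrite (reindex_inj (addIr k)) /=; apply: eq_bigr => j _.
have n0 : n.+1%:R != 0 :> R by rewrite pnatr_eq0.
rewrite /ngon /=; have [jk|jk] := ltnP (j + k) n.+1.
  by rewrite modn_small // natrD; congr F; field.
have -> : ((j + k) %% n.+1)%N = (j + k - n.+1)%N.
  by rewrite -{1}(subnK jk) modnDr modn_small //; have := ltn_ord j; have := ltn_ord k; lia.
by rewrite -[LHS]Fper natrB // natrD; congr F; field.
Qed.

Lemma ngon_sumN {R : realType} {n : nat} (F : R -> R) :
  (forall x, F (x + 2 * pi) = F x) ->
  \sum_(j < n) F (- ngon j) = \sum_(j < n) F (ngon j).
Proof.
case: n => [|n] Fper; first by rewrite !big_ord0.
rewrite (reindex_inj oppr_inj) /=; apply: eq_bigr => j _.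
have n0 : n.+1%:R != 0 :> R by rewrite pnatr_eq0.
(* The opposite of vertex 0 is 0 and not n, so this term takes no shift by a period. *)
have [j0|j0] := posnP j; first by rewrite /ngon /= j0 subn0 modnn mulr0 mul0r oppr0.
rewrite /ngon /= modn_small; last by lia.
rewrite -[LHS]Fper natrB; last exact: ltnW.
by congr F; field.
Qed.

Lemma ngon_sum_odd {R : realType} {n : nat} (F : R -> R) :
  (forall x, F (x + 2 * pi) = F x) -> (forall x, F (- x) = - F x) ->
  \sum_(j < n) F (ngon j) = 0.
Proof.
move=> Fper Fodd; have := ngon_sumN (n := n) F Fper.
by under eq_bigr do rewrite Fodd; rewrite sumrN => e; lra.
Qed.

Lemma two_pi {R : realType} : 2 * pi = pi *+ 2 :> R.
Proof. by rewrite mulr_natl. Qed.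

Lemma ngon_sum_sin {R : realType} {n : nat} : \sum_(j < n) sin (ngon j) = 0 :> R.
Proof.
by apply: ngon_sum_odd => x; [rewrite two_pi sinD2pi|rewrite sinN].
Qed.

(** Rotation by one vertex multiplies the sum by cos (2 pi / n), as the sine sum vanishes, and this
    factor is below 1. *)
Lemma ngon_sum_cos {R : realType} {n : nat} : (1 < n)%N ->
  \sum_(j < n) cos (ngon j) = 0 :> R.
Proof.
move=> n1; pose a : R := ngon (Ordinal n1).
have nR : 2 <= n%:R :> R by rewrite ler_nat.
have cosa : cos a < 1.
  have a0 : 0 < a by rewrite /a /ngon mulr1 divr_gt0 ?mulr_gt0 ?pi_gt0 //; lra.
  have api : a <= pi.
    rewrite /a /ngon mulr1 ler_pdivrMr; last lra.
    by rewrite mulrC ler_wpM2l ?pi_ge0.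
  by rewrite -cos0 ltr_cos // in_itv /=; lra.
have := ngon_sumB (@cos R) (Ordinal n1).
rewrite two_pi => /(_ (@cosD2pi R)); rewrite -/a.
under eq_bigr do rewrite cosB.
rewrite big_split /= -!mulr_suml ngon_sum_sin mul0r addr0 => /eqP.
rewrite -subr_eq0 -[X in _ - X]mulr1 -mulrBr mulf_eq0 => /orP[/eqP //|].
by rewrite subr_eq0 lt_eqF.
Qed.

(** The function y^-1 + y^2/2 decreases on (0, 1], so a lower bound [q] for the sine bounds [pot]
    above. Squares are compared because squared sines are what the half-angle formulas give. *)
Lemma pot_le {R : realType} (q d : R) :
  0 < q -> q ^+ 2 <= sin (d / 2) ^+ 2 -> pot d <= q^-1 + q ^+ 2 / 2.
Proof.
move=> q0; rewrite /pot -(real_normK (num_real (sin _))).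
have := sin_max (d / 2); move: `|sin _| (normr_ge0 (sin (d / 2))) => y y0 y1.
rewrite ler_pXn2r ?nnegrE ?(ltW q0) // => qy.
have {}y0 : 0 < y by exact: lt_le_trans qy.
rewrite -subr_ge0.
have -> : q^-1 + q ^+ 2 / 2 - (y^-1 + y ^+ 2 / 2)
    = (y - q) * ((1 - q * y) + q * y * (1 - (q + y) / 2)) / (q * y).
  by field; rewrite !gt_eqF.
have qy1 : q * y <= 1 by rewrite mulr_ile1 //; lra.
rewrite divr_ge0 ?mulr_ge0 ?subr_ge0 //; try lra.
by rewrite addr_ge0 ?subr_ge0 // mulr_ge0 ?mulr_ge0 //; lra.
Qed.

Lemma cosM2 {R : realType} (x : R) : cos (2 * x) = 2 * cos x ^+ 2 - 1.
Proof. by rewrite mulr_natl cos_mulr2n mulr_natl. Qed.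

Lemma sinM2 {R : realType} (x : R) : sin (2 * x) = 2 * (sin x * cos x).
Proof. by rewrite mulr_natl sin_mulr2n mulr_natl (mulrC (cos x)). Qed.

Lemma cospi3 {R : realType} : cos (pi / 3) = 1 / 2 :> R.
Proof.
have p := @pi_gt0 R.
have c0 : 0 < cos (pi / 3 : R) by apply: cos_gt0_pihalf; lra.
have : cos (2 * (pi / 3)) = - cos (pi / 3) :> R.
  by rewrite -[in RHS]cosN -cosDpi; congr cos; field.
rewrite cosM2; nra.
Qed.

(** Since 4 pi/5 = pi - pi/5, doubling twice gives a quartic in the cosine with spurious roots -1
    and 1/2, excluded by cos (pi/5) > cos (pi/3). *)
Lemma cospi5 {R : realType} : 4 * cos (pi / 5) ^+ 2 = 2 * cos (pi / 5) + 1 :> R.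
Proof.
have p := @pi_gt0 R.
have c0 : 0 < cos (pi / 5 : R) by apply: cos_gt0_pihalf; lra.
have e2 := cosM2 (pi / 5 : R); have e4 := cosM2 (2 * (pi / 5) : R).
have e : cos (2 * (2 * (pi / 5))) = - cos (pi / 5) :> R.
  by rewrite -[in RHS]cosN -cosDpi; congr cos; field.
have c12 : 1 / 2 < cos (pi / 5 : R).
  by rewrite -cospi3 ltr_cos ?in_itv /=; lra.
have : (cos (pi / 5) + 1) * (2 * cos (pi / 5) - 1)
    * (4 * cos (pi / 5) ^+ 2 - (2 * cos (pi / 5) + 1)) = 0 :> R.
  by move: e; rewrite e4 e2 => e; transitivity
    (2 * (2 * cos (pi / 5) ^+ 2 - 1) ^+ 2 - 1 + cos (pi / 5) : R);
    [ring|rewrite e addNr].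
move/eqP; rewrite mulf_eq0 mulf_eq0 => /orP[|/eqP/subr0_eq //].
by move=> /orP[] /eqP; lra.
Qed.

(** The upper bound on n enters only here. The self term is 0 and makes up for the others, each at
    least 3/2; at n = 6 the estimates give 8.84 < 9, while n = 7 would give about 10.97 > 10.5. *)
Lemma ngon_pot_sum_lt {R : realType} {n : nat} : (3 <= n <= 6)%N ->
  \sum_(j < n) pot (ngon j) < n%:R * (3 / 2) :> R.
Proof.
move=> hn; have {hn} : n \in [:: 3; 4; 5; 6]%N by rewrite !inE; lia.
rewrite -(big_mkord xpredT (fun j => pot (2 * pi * j%:R / n%:R))).
have p := @pi_gt0 R.
have half (x : R) : 2 * x / 2 = x by field.
have sin2 (x : R) : 2 * sin x ^+ 2 = 1 - cos (2 * x).
  by rewrite cosM2 sin2cos2; ring.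
have s2 : sin (pi / 2 : R) ^+ 2 = 1 by rewrite sin_pihalf expr1n.
have s3 : sin (pi / 3 : R) ^+ 2 = 3 / 4 by rewrite sin2cos2 cospi3; field.
have s4 : sin (pi / 4 : R) ^+ 2 = 1 / 2.
  have := sin2 (pi / 4); have -> : 2 * (pi / 4) = pi / 2 :> R by field.
  rewrite cos_pihalf; lra.
have s6 : sin (pi / 6 : R) ^+ 2 = 1 / 4.
  have := sin2 (pi / 6); have -> : 2 * (pi / 6) = pi / 3 :> R by field.
  rewrite cospi3; lra.
have c5 := @cospi5 R; have c50 : 0 < cos (pi / 5 : R) by apply: cos_gt0_pihalf; lra.
(* The value 0.809... is enclosed by means of its quadratic equation. *)
have c5u : cos (pi / 5 : R) < 81 / 100 by nra.
have c5l : 80 / 100 < cos (pi / 5 : R) by nra.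
have s51 : sin (pi / 5 : R) ^+ 2 >= (58 / 100) ^+ 2 by rewrite sin2cos2; nra.
have s52 : sin (2 * (pi / 5) : R) ^+ 2 >= (95 / 100) ^+ 2.
  by rewrite sin2cos2 cosM2; nra.
(* Each [q] given to [pot_le] is the sine truncated to two decimals. *)
have P2 : pot (2 * (pi / 2) : R) <= 3 / 2.
  by apply: (le_trans (pot_le 1 _ _ _)) => //; rewrite ?half ?s2; lra.
have P3 : pot (2 * (pi / 3) : R) <= 154 / 100.
  by apply: (le_trans (pot_le (86 / 100) _ _ _)); rewrite ?half ?s3; lra.
have P4 : pot (2 * (pi / 4) : R) <= 168 / 100.
  by apply: (le_trans (pot_le (70 / 100) _ _ _)); rewrite ?half ?s4; lra.
have P6 : pot (2 * (pi / 6) : R) <= 213 / 100.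
  by apply: (le_trans (pot_le (50 / 100) _ _ _)); rewrite ?half ?s6; lra.
have P51 : pot (2 * (pi / 5) : R) <= 190 / 100.
  by apply: (le_trans (pot_le (58 / 100) _ _ _)); rewrite ?half //; lra.
have P52 : pot (2 * (2 * (pi / 5)) : R) <= 151 / 100.
  by apply: (le_trans (pot_le (95 / 100) _ _ _)); rewrite ?half //; lra.
(* Reflection folds the vertices beyond the half turn onto the others. *)
have refl (x y : R) : x + y = 2 * pi -> pot x = pot y.
  by move=> xy; rewrite -potN -potD2pi; congr pot; lra.
have potE (x y : R) : x = y -> pot x = pot y by move->.
rewrite !inE => /or4P[]/eqP->; rewrite unlock /= mulr0 mul0r pot0.
- rewrite (refl (2 * pi * 2 / 3) (2 * (pi / 3))); last by field.
  rewrite (potE (2 * pi * 1 / 3) (2 * (pi / 3))); last by field.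
  lra.
- rewrite (refl (2 * pi * 3 / 4) (2 * (pi / 4))); last by field.
  rewrite (potE (2 * pi * 1 / 4) (2 * (pi / 4))); last by field.
  rewrite (potE (2 * pi * 2 / 4) (2 * (pi / 2))); last by field.
  lra.
- rewrite (refl (2 * pi * 4 / 5) (2 * (pi / 5))); last by field.
  rewrite (refl (2 * pi * 3 / 5) (2 * (2 * (pi / 5)))); last by field.
  rewrite (potE (2 * pi * 1 / 5) (2 * (pi / 5))); last by field.
  rewrite (potE (2 * pi * 2 / 5) (2 * (2 * (pi / 5)))); last by field.
  lra.
- rewrite (refl (2 * pi * 5 / 6) (2 * (pi / 6))); last by field.
  rewrite (refl (2 * pi * 4 / 6) (2 * (pi / 3))); last by field.
  rewrite (potE (2 * pi * 1 / 6) (2 * (pi / 6))); last by field.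
  rewrite (potE (2 * pi * 2 / 6) (2 * (pi / 3))); last by field.
  rewrite (potE (2 * pi * 3 / 6) (2 * (pi / 2))); last by field.
  lra.
Qed.

(** * Dot product and orthonormal frames in space *)

Lemma dotC {R : realType} {d : nat} (u v : 'rV[R]_d) : dot u v = dot v u.
Proof. by apply: eq_bigr => i _; rewrite mulrC. Qed.

Lemma dotDl {R : realType} {d : nat} (u v w : 'rV[R]_d) :
  dot (u + v) w = dot u w + dot v w.
Proof. by rewrite -big_split; apply: eq_bigr => i _; rewrite mxE mulrDl. Qed.

Lemma dotZl {R : realType} {d : nat} (a : R) (u w : 'rV[R]_d) :
  dot (a *: u) w = a * dot u w.
Proof. by rewrite /dot mulr_sumr; apply: eq_bigr => i _; rewrite mxE mulrA. Qed.

Lemma dotBl {R : realType} {d : nat} (u v w : 'rV[R]_d) :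
  dot (u - v) w = dot u w - dot v w.
Proof. by rewrite dotDl -scaleN1r dotZl mulN1r. Qed.

Lemma dotDr {R : realType} {d : nat} (u v w : 'rV[R]_d) :
  dot w (u + v) = dot w u + dot w v.
Proof. by rewrite dotC dotDl !(dotC w). Qed.

Lemma dotZr {R : realType} {d : nat} (a : R) (u w : 'rV[R]_d) :
  dot w (a *: u) = a * dot w u.
Proof. by rewrite dotC dotZl (dotC w). Qed.

Lemma dot_eq0 {R : realType} {d : nat} (u : 'rV[R]_d) : dot u u = 0 -> u = 0.
Proof.
move=> u0; apply/rowP => i; rewrite mxE.
by apply: (@sqr_sum_eq0 R d (fun i => u 0 i)); rewrite -/(dot u u) u0.
Qed.

Lemma enorm_sqr {R : realType} {d : nat} (u : 'rV[R]_d) : enorm u ^+ 2 = dot u u.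
Proof. by rewrite sqr_sqrtr //; apply: sumr_ge0 => i _; rewrite -expr2 sqr_ge0. Qed.

Lemma dot3 {R : realType} (u v : 'rV[R]_3) :
  dot u v = u 0 0 * v 0 0 + u 0 1 * v 0 1 + u 0 2 * v 0 2.
Proof.
rewrite /dot !big_ord_recl big_ord0 addr0 addrA.
by congr (_ * _ + _ * _ + _ * _); congr (_ _ _); apply/val_inj.
Qed.

Definition cross {R : realType} (u v : 'rV[R]_3) : 'rV[R]_3 :=
  \row_i [:: u 0 1 * v 0 2 - u 0 2 * v 0 1;
             u 0 2 * v 0 0 - u 0 0 * v 0 2;
             u 0 0 * v 0 1 - u 0 1 * v 0 0]`_i.

(* The Gram determinant of three vectors is the square of their determinant. *)
Lemma dot_cross_sqr {R : realType} (u v z : 'rV[R]_3) :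
  dot z (cross u v) ^+ 2 =
    dot z z * (dot u u * dot v v - dot u v ^+ 2)
    - dot z u * (dot z u * dot v v - dot u v * dot z v)
    + dot z v * (dot z u * dot u v - dot u u * dot z v).
Proof. by rewrite !dot3 !mxE /=; ring. Qed.

Lemma dot_cross_cross {R : realType} (u v : 'rV[R]_3) :
  dot (cross u v) (cross u v) = dot u u * dot v v - dot u v ^+ 2.
Proof. by rewrite !dot3 !mxE /=; ring. Qed.

Lemma dot_crossl {R : realType} (u v : 'rV[R]_3) : dot u (cross u v) = 0.
Proof. by rewrite !dot3 !mxE /=; ring. Qed.

Lemma dot_crossr {R : realType} (u v : 'rV[R]_3) : dot v (cross u v) = 0.
Proof. by rewrite !dot3 !mxE /=; ring. Qed.

(** The witness is the normalized cross product of u and w. The residual [z] of y is orthogonal to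
    u, w and their cross product, so the Gram identity gives |z|^2 |w|^2 = 0. *)
Lemma plane_frame {R : realType} (u w : 'rV[R]_3) :
  w != 0 -> dot u u = 1 -> dot u w = 0 ->
  exists v, [/\ dot v v = 1, dot u v = 0 &
    forall y, dot y w = 0 -> y = dot y u *: u + dot y v *: v].
Proof.
move=> w0 uu uw.
have ww : 0 < dot w w.
  rewrite lt_neqAle -enorm_sqr sqr_ge0 andbT enorm_sqr eq_sym.
  by apply: contra w0 => /eqP/dot_eq0 ->.
pose N := enorm w.
have N0 : N != 0 by rewrite -sqrf_eq0 enorm_sqr gt_eqF.
have NN : N * N = dot w w by rewrite -expr2 enorm_sqr.
have cc : dot (cross u w) (cross u w) = N * N.
  by rewrite dot_cross_cross uu uw NN; ring.
have [v [vv vu vw vc]] : exists v, [/\ dot v v = 1, dot v u = 0, dot v w = 0 &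
    forall z, dot z v = N^-1 * dot z (cross u w)].
  exists (N^-1 *: cross u w); split; rewrite ?dotZl ?dotZr ?cc.
  - by field.
  - by rewrite dotC dot_crossl mulr0.
  - by rewrite dotC dot_crossr mulr0.
  - by move=> z; rewrite dotZr.
exists v; split=> [//||y yw]; first by rewrite dotC.
apply/subr0_eq/dot_eq0; set z := y - _.
have zu : dot z u = 0 by rewrite dotBl dotDl !dotZl uu vu; ring.
have zv : dot z v = 0 by rewrite dotBl dotDl !dotZl vv (dotC u) vu; ring.
have zw : dot z w = 0 by rewrite dotBl dotDl !dotZl uw yw vw; ring.
have zc : dot z (cross u w) = 0.
  by apply/eqP; move/eqP: zv; rewrite vc mulf_eq0 invr_eq0 (negPf N0).
have := dot_cross_sqr u w z; rewrite zc zu zw uu uw => e.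
have : dot z z * dot w w = 0 by rewrite -[RHS](expr0n R 2) e; ring.
by move/eqP; rewrite mulf_eq0 (gt_eqF ww) orbF => /eqP.
Qed.

(** * Angles and their order *)

(** The angle is acos p when q >= 0 and 2 pi - acos p otherwise; the range [0, 2 pi) later keeps all
    differences of angles below 2 pi. *)
Lemma angle_exists {R : realType} (p q : R) : p ^+ 2 + q ^+ 2 = 1 ->
  exists t, [/\ 0 <= t, t < 2 * pi, cos t = p & sin t = q].
Proof.
move=> pq; have pi0 := @pi_gt0 R.
have pb : -1 <= p <= 1.
  rewrite -ler_norml -(expr_le1 (n := 2)) // real_normK ?num_real // -pq.
  by rewrite lerDl sqr_ge0.
have cp : cos (acos p) = p by apply: acosK; rewrite in_itv.
have sp : sin (acos p) = `|q|.
  rewrite sin_acos // -pq (_ : _ - _ = q ^+ 2) ?sqrtr_sqr //; ring.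
have a0 := acos_ge0 pb; have a1 := acos_lepi pb.
have [q0|q0] := leP 0 q.
  by exists (acos p); split=> //; [lra|rewrite sp ger0_norm].
exists (- acos p + pi *+ 2); rewrite sinD2pi cosD2pi sinN cosN sp cp ltr0_norm //.
rewrite opprK mulr2n; split=> //; first lra.
(* Strictness keeps the angle below 2 pi: acos p = 0 would force |q| = 0, against q < 0. *)
suff : 0 < acos p by lra.
rewrite lt_neqAle a0 andbT eq_sym; apply/negP => /eqP e.
by move: sp; rewrite e sin0 ltr0_norm //; lra.
Qed.

(** The rank counts the smaller values. It will send each body to a vertex of the regular n-gon,
    keeping the order of the angles. *)
Lemma rank_perm {R : realType} {n : nat} (a : 'I_n -> R) : injective a ->
  exists s : {perm 'I_n}, forall i j, (a i < a j) = (s i < s j)%N.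
Proof.
move=> ainj; pose rk i := #|[pred j | a j < a i]|.
have rk_lt i : (rk i < n)%N.
  rewrite -[X in (_ < X)%N]card_ord; apply: proper_card; apply/properP; split.
    exact/fintype.subsetP.
  by exists i; rewrite ?inE ?ltxx.
have rk_mono i j : a i < a j -> (rk i < rk j)%N.
  move=> ij; apply: proper_card; apply/properP; split.
    by apply/fintype.subsetP => k; rewrite !inE => /lt_trans; apply.
  by exists i; rewrite !inE ?ltxx.
have rk_iff i j : (a i < a j) = (rk i < rk j)%N.
  case: (ltgtP (a i) (a j)) => [/rk_mono ->//|/rk_mono/ltnW h|/ainj ->].
    by rewrite ltnNge h.
  by rewrite ltnn.
have rk_inj : injective (fun i => Ordinal (rk_lt i)).
  move=> i j /(congr1 val)/= e; apply: ainj; apply/le_anti.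
  by rewrite !leNgt !rk_iff e ltnn.
by exists (perm rk_inj) => i j; rewrite !permE /= rk_iff.
Qed.

(** * Central configuration equations on a circle *)

Definition cis {R : realType} {d : nat} (u v : 'rV[R]_d) (t : R) : 'rV[R]_d :=
  cos t *: u + sin t *: v.

Lemma dot_frame {R : realType} {d : nat} (u v : 'rV[R]_d) (p q p' q' : R) :
  dot u u = 1 -> dot v v = 1 -> dot u v = 0 ->
  dot (p *: u + q *: v) (p' *: u + q' *: v) = p * p' + q * q'.
Proof.
by move=> uu vv uv; rewrite !(dotDl, dotDr, dotZl, dotZr) (dotC v u) uu vv uv; ring.
Qed.

Lemma frame_inj {R : realType} {d : nat} (u v : 'rV[R]_d) (p q p' q' : R) :
  dot u u = 1 -> dot v v = 1 -> dot u v = 0 ->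
  p *: u + q *: v = p' *: u + q' *: v -> p = p' /\ q = q'.
Proof.
move=> uu vv uv e; split.
  by have := congr1 (fun y => dot y u) e;
    rewrite !(dotDl, dotZl) (dotC v u) uu uv !mulr0 !addr0 !mulr1.
by have := congr1 (fun y => dot y v) e;
  rewrite !(dotDl, dotZl) vv uv !mulr0 !add0r !mulr1.
Qed.

(* [cis v (- u)] is the derivative of [cis u v]. *)
Lemma cis_rot {R : realType} {d : nat} (u v : 'rV[R]_d) (t h : R) :
  cis u v (t + h) = cos h *: cis u v t + sin h *: cis v (- u) t.
Proof.
rewrite /cis cosD sinD !scalerDr !scalerN !scalerA !scalerBl !scalerDl.
rewrite (mulrC (cos h)) (mulrC (cos h) (sin t)) (mulrC (sin h)) (mulrC (sin h) (sin t)).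
by rewrite -!addrA; congr (_ + _); rewrite addrC -addrA; congr (_ + _); rewrite addrC.
Qed.

Lemma cis_frame {R : realType} {d : nat} (u v : 'rV[R]_d) (t : R) :
  dot u u = 1 -> dot v v = 1 -> dot u v = 0 ->
  [/\ dot (cis u v t) (cis u v t) = 1, dot (cis v (- u) t) (cis v (- u) t) = 1 &
    dot (cis u v t) (cis v (- u) t) = 0].
Proof.
move=> uu vv uv.
have -> : cis v (- u) t = - sin t *: u + cos t *: v.
  by rewrite /cis scalerN scaleNr addrC.
rewrite !dot_frame //; have := cos2Dsin2 t; split; lra.
Qed.

(** With h = s - t, the radial part cos h - 1 and the tangential part sin h are written in h/2, the
    variable of [pot]. *)
Lemma cisB {R : realType} {d : nat} (u v : 'rV[R]_d) (s t : R) :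
  cis u v s - cis u v t =
    - (2 * sin ((s - t) / 2) ^+ 2) *: cis u v t
    + (2 * (sin ((s - t) / 2) * cos ((s - t) / 2))) *: cis v (- u) t.
Proof.
have {1}-> : s = t + 2 * ((s - t) / 2) by field.
rewrite cis_rot cosM2 sinM2 cos2sin2 addrAC; congr (_ + _).
by rewrite -[X in _ - X]scale1r -scalerBl; congr (_ *: _); ring.
Qed.

Lemma enorm_cisB {R : realType} {d : nat} (u v : 'rV[R]_d) (s t : R) :
  dot u u = 1 -> dot v v = 1 -> dot u v = 0 ->
  enorm (cis u v s - cis u v t) = 2 * `|sin ((s - t) / 2)|.
Proof.
move=> uu vv uv; have [ee ff ef] := cis_frame u v t uu vv uv.
rewrite /enorm cisB dot_frame //.
have := cos2Dsin2 ((s - t) / 2); move: (sin _) (cos _) => p q pq.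
have -> : - (2 * p ^+ 2) * - (2 * p ^+ 2) + 2 * (p * q) * (2 * (p * q))
    = (2 * p) ^+ 2 * (q ^+ 2 + p ^+ 2) by ring.
by rewrite pq mulr1 sqrtr_sqr normrM ger0_norm.
Qed.

(* Radial and tangential components of the force; as in [pot], the terms
   [j = k] vanish since [0^-1 = 0]. *)
Lemma central_configuration_cis {R : realType} {n : nat} (m : 'I_n -> R)
    (x : 'I_n -> 'rV[R]_3) (a : 'I_n -> R) (u v : 'rV[R]_3) (r : R) :
  dot u u = 1 -> dot v v = 1 -> dot u v = 0 -> 0 < r -> (forall k, 0 < m k) ->
  (forall k, x k = center_of_mass m x + r *: cis u v (a k)) ->
  central_configuration m x <->
  exists K, forall k,
    \sum_j m j * `|sin ((a j - a k) / 2)|^-1 = K /\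
    \sum_j m j * (cos ((a j - a k) / 2)
      / (sin ((a j - a k) / 2) * `|sin ((a j - a k) / 2)|)) = 0.
Proof.
move=> uu vv uv r0 m0 xE; set c := center_of_mass m x in xE *.
have rn0 : r != 0 by rewrite gt_eqF.
pose A j k := m j * `|sin ((a j - a k) / 2)|^-1.
pose B j k := m j * (cos ((a j - a k) / 2)
      / (sin ((a j - a k) / 2) * `|sin ((a j - a k) / 2)|)).
have xB j k : x j - x k = r *: (cis u v (a j) - cis u v (a k)).
  by rewrite !xE opprD addrACA subrr add0r scalerBr.
have enormE j k : enorm (x j - x k) = r * (2 * `|sin ((a j - a k) / 2)|).
  rewrite xB -(enorm_cisB u v) // /enorm dotZl dotZr mulrA -expr2.
  by rewrite sqrtrM ?sqr_ge0 // sqrtr_sqr ger0_norm // ltW.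
have term j k : (m j * m k / enorm (x j - x k) ^+ 3) *: (x j - x k)
    = (m k / (4 * r ^+ 2)) *: (- A j k *: cis u v (a k) + B j k *: cis v (- u) (a k)).
  rewrite enormE xB cisB scalerA [in RHS]scalerDr [in LHS]scalerDr !scalerA /A /B.
  (* Here both sides are zero by 0^-1 = 0, which covers j = k. *)
  have [->|s0] := eqVneq (sin ((a j - a k) / 2)) 0.
    by rewrite normr0 !(mul0r, invr0, mulr0, oppr0, scale0r, expr0n).
  have ns0 : `|sin ((a j - a k) / 2)| != 0 by rewrite normr_eq0.
  have ss : sin ((a j - a k) / 2) ^+ 2 = `|sin ((a j - a k) / 2)| ^+ 2.
    by rewrite real_normK ?num_real.
  congr (_ *: _ + _ *: _).
    by rewrite ss; field; rewrite ns0 rn0.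
  move: ss s0 ns0; move: (sin _) (cos _) `|_| => p q y ss p0 y0.
  have -> : q / (p * y) = p * q / (y ^+ 3).
    by rewrite [y ^+ 3]exprSr -ss; field; rewrite p0 y0.
  by field; rewrite y0 rn0.
have force k : \sum_(j < n | j != k)
      (m j * m k / enorm (x j - x k) ^+ 3) *: (x j - x k)
    = (m k / (4 * r ^+ 2) * - (\sum_j A j k)) *: cis u v (a k)
      + (m k / (4 * r ^+ 2) * \sum_j B j k) *: cis v (- u) (a k).
  transitivity (\sum_j (m j * m k / enorm (x j - x k) ^+ 3) *: (x j - x k)).
    by rewrite [RHS](bigD1 k) //= subrr scaler0 add0r.
  rewrite (eq_bigr _ (fun j _ => term j k)) -scaler_sumr big_split /=.
  by rewrite -!scaler_suml sumrN scalerDr !scalerA.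
have mr k : m k / (4 * r ^+ 2) != 0.
  by rewrite mulf_neq0 ?invr_eq0 ?mulf_neq0 ?expf_neq0 ?gt_eqF.
have rhs l k : - (l * m k) *: (x k - c) = - (l * m k) * r *: cis u v (a k)
     + 0 *: cis v (- u) (a k).
  by rewrite scale0r addr0 xE addrC addKr scalerA.
split=> [[l ccl]|[K hK]].
(* The radial component reads m k * K / (4 r^2) = l * m k * r, hence this constant. *)
- exists (4 * r ^+ 3 * l) => k; have [ee ff ef] := cis_frame u v (a k) uu vv uv.
  have := ccl k; rewrite force rhs => /(frame_inj _ _ _ _ _ _ ee ff ef)[eA eB].
  split; last by move/eqP: eB; rewrite mulf_eq0 (negPf (mr k)) => /eqP.
  apply: (mulfI (mr k)); apply: oppr_inj; rewrite -mulrN eA.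
  by field.
- exists (K / (4 * r ^+ 3)) => k; have [eA eB] := hK k.
  rewrite force rhs /A /B eA eB mulr0; congr (_ *: _ + _).
  by field.
Qed.

(** * Centering condition and the two implications *)

Lemma ngon_ge0 {R : realType} {n : nat} (k : 'I_n) : 0 <= ngon k :> R.
Proof. by rewrite /ngon divr_ge0 ?mulr_ge0 ?pi_ge0. Qed.

Lemma ltr_ngon {R : realType} {n : nat} (j k : 'I_n) :
  ((ngon j : R) < ngon k) = (j < k)%N.
Proof.
have n0 : 0 < n%:R :> R by rewrite ltr0n; case: n j {k} => [[]|].
by rewrite /ngon ltr_pM2r ?invr_gt0 // ltr_pM2l ?mulr_gt0 ?pi_gt0 // ltr_nat.
Qed.

Lemma ngon_ltB {R : realType} {n : nat} (j k : 'I_n) :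
  ngon j - ngon k < 2 * pi :> R.
Proof.
have n0 : 0 < n%:R :> R by rewrite ltr0n; case: n j {k} => [[]|].
rewrite ltrBlDr (lt_le_trans (y := 2 * pi)) ?lerDl ?ngon_ge0 //.
by rewrite /ngon ltr_pdivrMr // ltr_pM2l ?ltr_nat ?mulr_gt0 ?pi_gt0.
Qed.

Lemma ngon_perm_sumB {R : realType} {n : nat} (s : {perm 'I_n}) (F : R -> R) k :
  (forall x, F (x + 2 * pi) = F x) ->
  \sum_j F (ngon (s j) - ngon (s k)) = \sum_(j < n) F (ngon j).
Proof.
move=> Fper; rewrite -(ngon_sumB F (s k) Fper).
by rewrite [RHS](reindex_inj (@perm_inj _ s)).
Qed.

Lemma center_of_mass_sum {R : realType} {n : nat} (m : 'I_n -> R)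
    (x : 'I_n -> 'rV[R]_3) : \sum_k m k != 0 ->
  \sum_k m k *: (x k - center_of_mass m x) = 0.
Proof.
move=> M0; under eq_bigr do rewrite scalerBr.
by rewrite sumrB -scaler_suml /center_of_mass scalerA mulfV // scale1r subrr.
Qed.

(** The vanishing sum is resolved along the frame turned by [t], which will be the angle of each
    body in turn. *)
Lemma sum_cisB {R : realType} {n d : nat} (m : 'I_n -> R) (u v : 'rV[R]_d)
    (a : 'I_n -> R) (t : R) : dot u u = 1 -> dot v v = 1 -> dot u v = 0 ->
  \sum_k m k *: cis u v (a k) = 0 ->
  \sum_k m k * cos (a k - t) = 0 /\ \sum_k m k * sin (a k - t) = 0.
Proof.
move=> uu vv uv.
have -> : \sum_k m k *: cis u v (a k)
    = (\sum_k m k * cos (a k)) *: u + (\sum_k m k * sin (a k)) *: v.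
  rewrite !scaler_suml -big_split; apply: eq_bigr => k _ /=.
  by rewrite /cis scalerDr !scalerA.
rewrite -[RHS]addr0 -{1}(scale0r u) -(scale0r v) => /(frame_inj _ _ _ _ _ _ uu vv uv)[C S].
split.
  under eq_bigr do rewrite cosB mulrDr !mulrA.
  by rewrite big_split /= -!mulr_suml C S !mul0r addr0.
under eq_bigr do rewrite sinB mulrBr !mulrA.
by rewrite sumrB -!mulr_suml C S !mul0r subrr.
Qed.

(** As sin^2 (d/2) / 2 = (1 - cos d)/4, centering makes the term added to the Newtonian potential
    contribute a constant to each row and nothing to the tangential sums. *)
Lemma centered_balanced {R : realType} {n : nat} (m a : 'I_n -> R) (K : R) :
  (forall i, \sum_j m j * cos (a j - a i) = 0) ->
  (forall i, \sum_j m j * sin (a j - a i) = 0) ->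
  (forall i, \sum_j m j * `|sin ((a j - a i) / 2)|^-1 = K /\
    \sum_j m j * (cos ((a j - a i) / 2)
      / (sin ((a j - a i) / 2) * `|sin ((a j - a i) / 2)|)) = 0) ->
  balanced m a /\
  (forall i, \sum_j m j * pot (a j - a i) = K + (\sum_j m j) / 4).
Proof.
have half (d : R) : d = 2 * (d / 2) by field.
move=> C S KB; split=> i.
  transitivity ((\sum_j m j * sin (a j - a i)) / 2
    - \sum_j m j * (cos ((a j - a i) / 2)
        / (sin ((a j - a i) / 2) * `|sin ((a j - a i) / 2)|))); last first.
    by rewrite S (KB i).2 mul0r subrr.
  rewrite mulr_suml -sumrB; apply: eq_bigr => j _.
  rewrite /dpot mulrBr; congr (_ - _).
  by rewrite [in RHS](half (a j - a i)) sinM2; field.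
transitivity (\sum_j m j * `|sin ((a j - a i) / 2)|^-1
    + ((\sum_j m j) / 4 - (\sum_j m j * cos (a j - a i)) / 4)); last first.
  by rewrite C (KB i).1 mul0r subr0.
rewrite !mulr_suml -sumrB -big_split; apply: eq_bigr => j _ /=.
rewrite /pot mulrDr; congr (_ + _).
by rewrite [in RHS](half (a j - a i)) cosM2 sin2cos2; field.
Qed.

Lemma regular_of_central {R : realType} {n : nat} (m : 'I_n -> R)
    (x : 'I_n -> 'rV[R]_3) (w : 'rV[R]_3) (r : R) :
  (3 <= n <= 6)%N -> (forall k, 0 < m k) -> injective x -> w != 0 -> 0 < r ->
  (forall k, circle (center_of_mass m x) w r (x k)) ->
  central_configuration m x ->
  (forall j k, m j = m k) /\ regular_polygon x.
Proof.
move=> hn m0 xinj w0 r0; set c := center_of_mass m x => xC cc.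
have n0 : (0 < n)%N by move: hn; lia.
have rn0 : r != 0 by rewrite gt_eqF.
have pi0 := @pi_gt0 R.
have xr k : dot (x k - c) (x k - c) = r ^+ 2 by rewrite -enorm_sqr (xC k).1.
(* Any body supplies a unit vector in the plane of the circle. *)
pose u := r^-1 *: (x (Ordinal n0) - c).
have uu : dot u u = 1 by rewrite dotZl dotZr xr; field.
have uw : dot u w = 0 by rewrite dotZl (xC _).2 mulr0.
have [v [vv uv frame]] := plane_frame u w w0 uu uw.
have /choice[a ha] : forall k, exists t : R,
    [/\ 0 <= t, t < 2 * pi & x k = c + r *: cis u v t].
  move=> k; set y := r^-1 *: (x k - c).
  have yE := frame y; rewrite dotZl (xC k).2 mulr0 in yE; have {}yE := yE erefl.
  have yy : dot y y = 1 by rewrite dotZl dotZr xr; field.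
  have [|t [t0 t1 ct st]] := angle_exists (dot y u) (dot y v).
    by rewrite -yy [in RHS]yE dot_frame // !expr2.
  exists t; split=> //; rewrite /cis ct st -yE scalerA mulfV // scale1r addrC.
  by rewrite subrK.
have a_ge0 k : 0 <= a k by have [] := ha k.
have a_lt k : a k < 2 * pi by have [] := ha k.
have xE k : x k = c + r *: cis u v (a k) by have [] := ha k.
have ra i j : a j - a i < 2 * pi by have := a_ge0 i; have := a_lt j; lra.
have ainj : injective a by move=> i j aij; apply: xinj; rewrite !xE aij.
have [K hK] := (central_configuration_cis m x a u v r uu vv uv r0 m0 xE).1 cc.
have cis0 : \sum_k m k *: cis u v (a k) = 0.
  apply: (scalerI rn0); rewrite scaler0 scaler_sumr.
  rewrite -[RHS](center_of_mass_sum m x) ?gt_eqF ?sumr_gt0_ord //.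
  apply: eq_bigr => k _; rewrite -/c xE addrC addKr !scalerA; congr (_ *: _).
  exact: mulrC.
have [bal row] := centered_balanced m a K
  (fun i => (sum_cisB m u v a (a i) uu vv uv cis0).1)
  (fun i => (sum_cisB m u v a (a i) uu vv uv cis0).2) hK.
have [s hs] := rank_perm a ainj.
pose b i : R := ngon (s i).
have ab i j : (a i < a j) = (b i < b j) by rewrite ltr_ngon hs.
have balb : balanced (fun=> 1) b.
  move=> i; under eq_bigr do rewrite mul1r.
  by rewrite ngon_perm_sumB; [exact: ngon_sum_odd _ dpotD2pi dpotN|exact: dpotD2pi].
have rowb i : \sum_j pot (b j - b i) = \sum_(j < n) pot (ngon j).
  by rewrite ngon_perm_sumB //; exact: potD2pi.
have [mE aE] := centered_unique m a b _ _ n0 m0 ainj ab ra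
  (fun i j => ngon_ltB (s j) (s i)) bal row balb rowb (ngon_pot_sum_lt hn).
split=> //.
(* [i0] is the body matched with vertex 0, whose angle is 0, so the frame of the polygon is the
   first one turned by [a i0]. *)
pose i0 := (s^-1)%g (Ordinal n0).
have [ee ff ef] := cis_frame u v (a i0) uu vv uv.
exists c, (cis u v (a i0)), (cis v (- u) (a i0)), r, (s^-1)%g; split=> // k /=.
rewrite xE -cis_rot; congr (_ + _ *: cis _ _ _).
have := aE i0 ((s^-1)%g k); rewrite /b /i0 !permKV /ngon /= mulr0 mul0r subr0 => <-.
by rewrite addrC subrK.
Qed.

(** By rotation the radial sums agree at all vertices, and the tangential ones vanish by oddness
    under reflection. *)
Lemma central_of_regular {R : realType} {n : nat} (m : 'I_n -> R)
    (x : 'I_n -> 'rV[R]_3) :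
  (1 < n)%N -> (forall k, 0 < m k) -> (forall j k, m j = m k) ->
  regular_polygon x -> central_configuration m x.
Proof.
move=> n1 m0 mE [c [u [v [r [s [r0 uu vv uv xs]]]]]].
have n0 : (0 < n)%N by exact: ltnW.
pose mu := m (Ordinal n0).
have mmu k : m k = mu by exact: mE.
pose t := (s^-1)%g; pose a k : R := ngon (t k).
have xE' k : x k = c + r *: cis u v (a k).
  by rewrite -{1}(permKV s k) xs.
have sumF F : \sum_k F (a k) = \sum_(k < n) F (ngon k) :> R.
  by rewrite [RHS](reindex_inj (@perm_inj _ t)).
have cis0 : \sum_k cis u v (a k) = 0.
  rewrite /cis big_split /= -!scaler_suml (sumF cos) (sumF sin).
  by rewrite ngon_sum_cos // ngon_sum_sin !scale0r addr0.
have M0 : \sum_k m k != 0 by rewrite gt_eqF ?sumr_gt0_ord.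
(* The center of the polygon is the center of mass because the masses are equal and the vertex
   directions sum to 0. *)
have cE : center_of_mass m x = c.
  rewrite /center_of_mass; under [X in _ *: X]eq_bigr do rewrite xE' scalerDr.
  rewrite big_split /= -scaler_suml scalerDr scalerA mulVf // scale1r.
  under [X in _ + _ *: X]eq_bigr do rewrite mmu scalerA.
  by rewrite -scaler_sumr cis0 !scaler0 addr0.
have xE k : x k = center_of_mass m x + r *: cis u v (a k) by rewrite cE.
apply/(central_configuration_cis m x a u v r uu vv uv r0 m0 xE).
pose F d : R := `|sin (d / 2)|^-1.
pose G d : R := cos (d / 2) / (sin (d / 2) * `|sin (d / 2)|).
have Fper d : F (d + 2 * pi) = F d by rewrite /F half_2pi sinDpi normrN.
have Gper d : G (d + 2 * pi) = G d.
  by rewrite /G half_2pi sinDpi cosDpi normrN !mulNr invrN mulrN opprK.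
have Godd d : G (- d) = - G d.
  by rewrite /G mulNr sinN cosN normrN mulNr invrN mulrN.
exists (mu * \sum_(j < n) F (ngon j)) => k; split.
  under eq_bigr do rewrite mmu.
  by rewrite -mulr_sumr (ngon_perm_sumB t F k Fper).
under eq_bigr do rewrite mmu.
by rewrite -mulr_sumr (ngon_perm_sumB t G k Gper) ngon_sum_odd // mulr0.
Qed.

Theorem corollary1p1 (R : realType) (n : nat) (hn : (3 <= n <= 6)%N)
    (m : 'I_n -> R) (x : 'I_n -> 'rV[R]_3)
    (m_gt0 : forall k, 0 < m k)
    (x_distinct : injective x)
    (x_circle : exists C : set 'rV[R]_3,
        is_circle_centered (center_of_mass m x) C /\ (forall k, C (x k))) :
  central_configuration m x <->
  (forall j k, m j = m k) /\ regular_polygon x.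
Proof.
split=> [cc|[mE reg]]; last first.
  by apply: central_of_regular => //; case/andP: hn => /ltnW.
have [C [[w [r [w0 r0 ->]]] xC]] := x_circle.
exact: regular_of_central hn m_gt0 x_distinct w0 r0 xC cc.
Qed.
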